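(* Let $(X_n)_{n\geq 1}$ be a sequence of identically distributed real-valued random variables on a probability space $(\Omega,\mathcal{F},P)$ with finite first moment, i.e. $E|X_1|<\infty$. For $t\in[-\pi,\pi)$ let $S_n(t)=\sum_{k=1}^{n}e^{ikt}X_k$. Then for almost all $t\in[-\pi,\pi)$, $$\lim_{n\to\infty}\frac{S_n(t)}{n}=0\qquad P\text{-a.s.}$$
   Context: ''Almost all $t$'' is with respect to Lebesgue measure on $[-\pi,\pi)$; the $P$-null set may depend on $t$. No independence or other dependence assumption is made on the sequence $(X_n)$. Here $i$ denotes the imaginary unit. *)

(* Defs.v *)
From HB Require Import structures.
From mathcomp Require Import all_boot all_order all_algebra.
From mathcomp Require Import complex.
From mathcomp Require Import all_classical all_reals all_analysis.

Set Implicit Arguments.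
Unset Strict Implicit.
Unset Printing Implicit Defensive.

Import Order.TTheory GRing.Theory Num.Theory.
Import numFieldNormedType.Exports.

Local Open Scope classical_set_scope.
Local Open Scope ring_scope.
Local Open Scope complex_scope.

(* The complex plane with the topology of the modulus: the topology of a
   numFieldType is keyed on the structure, not on its carrier [R[i]]. *)
Definition complex_plane (R : realType) : numFieldType := R[i].

Definition cexp (R : realType) (z : R[i]) : R[i] :=
  (expR (complex.Re z))%:C *
  (cos (complex.Im z) +i* sin (complex.Im z)).

(* The laws are compared on Borel sets only: [distribution P X] is a function on
   all sets, and its values on non-measurable sets are meaningless. *)
Definition identically_distributed (d : measure_display) (T : measurableType d)
    (R : realType) (P : probability T R) (X : nat -> {RV P >-> R})
    (I : set nat) : Prop :=
  forall m n, I m -> I n -> forall A : set R, measurable A ->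
    distribution P (X m) A = distribution P (X n) A.

Definition trig_sum (R : realType) (T : Type) (X : nat -> T -> R)
    (n : nat) (t : R) (w : T) : complex_plane R :=
  \sum_(1 <= k < n.+1) cexp ('i * k%:R * t%:C) * (X k w)%:C.

(* Main.v *)
Require Import Defs.
From mathcomp Require Import all_boot all_order all_algebra.
From mathcomp Require Import complex ring lra zify.
From mathcomp Require Import all_classical all_reals all_analysis.
From mathcomp Require Import measurable_realfun.

Set Implicit Arguments.
Unset Strict Implicit.
Unset Printing Implicit Defensive.

Import Order.TTheory GRing.Theory Num.Theory.
Import numFieldNormedType.Exports.

Local Open Scope classical_set_scope.
Local Open Scope ring_scope.
Local Open Scope complex_scope.

(** Since nothing is known about the joint law of the [X k], the averages are
    controlled one sample point at a time: for almost every [w] the numbers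
    [x k = X k w] are shown to be coefficients for which the averages of
    [x k * e^(ikt)] converge for almost every [t], and Tonelli's theorem
    ([ae_swap_cvg0]) then exchanges the two exceptional sets.

    Probability enters through one expectation.  With
    [trunc_pow y = min (1, |y|^(3/2))], the series over [j] of
    [2^j * trunc_pow (x / 2^j)] is at most [6 |x|], so, the laws being equal and
    [X 1] integrable,
    [\sum_j \sum_(1 <= k <= 2^j) trunc_pow (X k / 2^j)] has a finite
    expectation and is almost surely finite ([ae_dyadic_mass_summable]).  Its
    finiteness contains both halves of a truncation argument: eventually
    [|X k| < 2^j] for all [k <= 2^j], and the coefficients [a k = X k / 2^j] of
    the scale [j] have [l^(3/2)] masses [s j] that are summable in [j].

    Having the exponent 3/2, smaller than 2, is what spares Carleson's theorem.
    For coefficients in [l^p] with [p < 2], the maximal partial sum of an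
    orthogonal series is bounded in [L^2] by an elementary argument (Menshov,
    Paley, Christ and Kiselev): cut the index interval at a point that splits
    the mass [s] of [|a|^p] into two halves.  Each half has at most the mass
    [s / 2], and since [2 (s / 2)^(2/p)] is smaller than [s^(2/p)] by a fixed
    factor, the two maximal functions of the halves can simply be added, and
    the recursion closes ([bessel_maximal], with [p = 3/2]).

    At the scale [j] this gives a function [G j] that dominates
    [(S_n(t) / 2^j)^2] for every [n <= 2^j], with an integral of order [s j].
    So [\sum_j G j] is finite almost everywhere, [G j t] tends to 0, and every
    [n] is comparable with a power of 2 ([bessel_averages]).  The cosines and
    the sines on a period satisfy Bessel's inequality, and give the real and
    the imaginary part. *)

(** * Powers and dyadic sums *)

Section Powers.
Variable R : realType.
Implicit Types (x y c s q : R) (m n J : nat).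

(** Bounds a power with a rational exponent by integer arithmetic. *)
Lemma powR_ratio_le x c (a b : nat) : (0 < b)%N -> 0 <= x -> 0 <= c ->
  x ^+ a <= c ^+ b -> x `^ (a%:R / b%:R) <= c.
Proof.
move=> b0 x0 c0 xc; rewrite -(ler_pXn2r b0) ?nnegrE ?powR_ge0 //.
rewrite -powR_mulrn ?powR_ge0 // -powRrM divfK ?pnatr_eq0 -?lt0n //.
by rewrite powR_mulrn.
Qed.

Lemma powR_superadditive x y q : 1 <= q -> 0 <= x -> 0 <= y ->
  x `^ q + y `^ q <= (x + y) `^ q.
Proof.
move=> q1; have qE z : 0 <= z -> z `^ q = z * z `^ (q - 1).
  rewrite le_eqVlt => /predU1P[<-|z0].
    by rewrite mul0r powR0 // gt_eqF // (lt_le_trans ltr01).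
  by rewrite -{2}[z]powRr1 ?ltW // -powRD ?subrKC // (gt_eqF z0) implybT.
move=> x0 y0; rewrite !qE ?addr_ge0 // mulrDl.
by rewrite lerD // ler_wpM2l // ge0_ler_powR ?nnegrE ?subr_ge0 ?addr_ge0 //
  (lerDl, lerDr).
Qed.

Lemma powR_superadditive_sum (w : nat -> R) q m n : 1 <= q ->
  (forall i, 0 <= w i) ->
  \sum_(m <= i < n) w i `^ q <= (\sum_(m <= i < n) w i) `^ q.
Proof.
move=> q1 w0; suff [] : \sum_(m <= i < n) w i `^ q <=
    (\sum_(m <= i < n) w i) `^ q /\ 0 <= \sum_(m <= i < n) w i by [].
elim/big_ind2: _ => [|x1 x2 y1 y2 [x12 x20] [y12 y20]|i _].
- by rewrite powR_ge0.
- rewrite addr_ge0 //; split=> //.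
  by rewrite (le_trans (lerD x12 y12)) ?powR_superadditive.
- by rewrite w0.
Qed.

(** The constant 2/5 only has to be below 1/2: halving the mass must more than
    halve its power, which is where the exponent being above 1 is used. *)
Lemma powR_half_le s : 0 <= s -> (s / 2) `^ (4 / 3) <= 2 / 5 * s `^ (4 / 3).
Proof.
move=> s0; rewrite powRM ?invr_ge0 // mulrC ler_wpM2r ?powR_ge0 //.
by apply: powR_ratio_le => //; lra.
Qed.

Definition trunc_pow x : R := Num.min 1 (`|x| `^ (3 / 2)).

Lemma trunc_pow_ge0 x : 0 <= trunc_pow x.
Proof. by rewrite /trunc_pow le_min ler01 powR_ge0. Qed.

(** Terms with [2 ^ j <= |x|] are dominated by a geometric sum increasing up to
    its last term, of order [|x|]; the others, of order
    [|x| ^ (3/2) * 2 ^ (- j / 2)], by one decreasing from its first term, again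
    of order [|x|].  The induction compares the sum with [4 |x| ^ (3/2)] on
    [|x| < 1] and with [6 |x| - 1] elsewhere, a function [B] that satisfies
    [trunc_pow x + 2 B (x / 2) <= B x]. *)
Lemma sum_dyadic_trunc_pow_le x J :
  \sum_(0 <= j < J) 2 ^+ j * trunc_pow (x / 2 ^+ j) <= 6 * `|x|.
Proof.
pose B y : R := if `|y| < 1 then 4 * `|y| `^ (3 / 2) else 6 * `|y| - 1.
have powB y : `|y| <= 1 -> `|y| `^ (3 / 2) <= `|y|.
  move=> y1; apply: powR_ratio_le => //.
  by rewrite [_ ^+ 3]exprS ler_piMl ?exprn_ge0.
have halfB y : `|y / 2| `^ (3 / 2) <= 3 / 8 * `|y| `^ (3 / 2).
  rewrite normrM [`|2^-1|]ger0_norm ?invr_ge0 // powRM // ?invr_ge0 // mulrC.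
  rewrite ler_wpM2r ?powR_ge0 //.
  by apply: powR_ratio_le => //; lra.
have norm2 y : `|y / 2| = `|y| / 2 by rewrite normrM [`|2^-1|]ger0_norm ?invr_ge0.
have stepB y : trunc_pow y + 2 * B (y / 2) <= B y.
  have t1 : trunc_pow y <= 1 by rewrite /trunc_pow ge_min lexx.
  have t2 : trunc_pow y <= `|y| `^ (3 / 2) by rewrite /trunc_pow ge_min lexx orbT.
  have := halfB y; have := powB (y / 2); have := normr_ge0 y; rewrite /B !norm2.
  case: (ltP `|y| 1) => y1; case: (ltP (`|y| / 2) 1) => y2 y0 pow_y half_y;
    lra.
have B0 y : 0 <= B y.
  by rewrite /B; case: ltP => h; rewrite ?mulr_ge0 ?powR_ge0 //; lra.
have BJ : forall y, \sum_(0 <= j < J) 2 ^+ j * trunc_pow (y / 2 ^+ j) <= B y.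
  elim: J => [|J IH] y; first by rewrite big_geq.
  rewrite big_nat_recl // expr0 mul1r divr1.
  apply: le_trans (stepB y); rewrite lerD2l.
  apply: le_trans (ler_wpM2l _ (IH (y / 2))) => //.
  rewrite mulr_sumr ler_sum // => j _.
  by rewrite exprS invfM -[2 * _ * _]mulrA [y * _]mulrA.
apply: le_trans (BJ x) _; have := powB x; have := normr_ge0 x.
rewrite /B; case: (ltP `|x| 1) => x1 x0 pow_x; last by lra.
by have := pow_x (ltW x1); lra.
Qed.

End Powers.

(** * The maximal inequality *)

Section MaximalInequality.
Variable R : realType.

(** One index is left out between the two parts: its own weight may exceed half
    of the total. *)
Lemma half_mass_index (w : nat -> R) m n : (m < n)%N ->
  (forall i, 0 <= w i) ->
  exists k, [/\ (m <= k < n)%N,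
    \sum_(m <= i < k) w i <= (\sum_(m <= i < n) w i) / 2 &
    \sum_(k.+1 <= i < n) w i <= (\sum_(m <= i < n) w i) / 2].
Proof.
move=> mn w0; set s := \sum_(m <= i < n) w i.
have s0 : 0 <= s by rewrite sumr_ge0.
pose Q k := (m <= k)%N && (s / 2 <= \sum_(m <= i < k.+1) w i).
have Qn : Q n.-1.
  by rewrite /Q (ltn_predK mn) -/s -ltnS (ltn_predK mn) mn; lra.
have [k /andP[mk sk] kmin] := ex_minnP (ex_intro Q _ Qn).
have kn : (k < n)%N by rewrite -(ltn_predK mn) ltnS kmin.
exists k; split; first by rewrite mk.
- move: mk; rewrite leq_eqVlt => /predU1P[<-|mk].
    by rewrite big_geq // divr_ge0.
  rewrite leNgt; apply/negP => /ltW sk1.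
  have := kmin k.-1; rewrite /Q (ltn_predK mk) sk1 andbT -ltnS (ltn_predK mk) mk.
  by move=> /(_ isT); rewrite -ltnS (ltn_predK mk) ltnn.
- have : s = \sum_(m <= i < k.+1) w i + \sum_(k.+1 <= i < n) w i.
    by rewrite -big_cat_nat // (leq_trans mk).
  by move: sk; set u := bigop _ _ _; set v := bigop _ _ _; lra.
Qed.

Variables (d : measure_display) (T : measurableType d).
Variable mu : {measure set T -> \bar R}.

(** Bessel's inequality up to a constant, for the synthesis operator; every
    orthogonal system bounded in [L^2] satisfies it. *)
Definition bessel_system (f : nat -> T -> R) (C : R) : Prop :=
  forall (a : nat -> R) m n,
    (\int[mu]_t ((\sum_(m <= i < n) a i * f i t) ^+ 2)%:E <=
     (C * \sum_(m <= i < n) a i ^+ 2)%:E)%E.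

(** For [G1] and [G2] given by induction on the two sides of the half-mass index
    [k0], and [S] the sum up to [k0] included, a partial sum either stops before
    [k0], or is [S] plus a partial sum of the right side; hence
    [G = 6/5 (G1 + G2) + 6 S^2].  The weights 6/5 and 6 come from
    [(x + y)^2 <= 6 x^2 + 6/5 y^2].  As [(s / 2)^(4/3) <= 2/5 s^(4/3)], the
    constant [K] has to satisfy [2 * 6/5 * 2/5 * K + 6 C <= K], that is,
    [K >= 150 C].  The square of the maximal function is replaced by such a
    [G], a finite sum of squares, so that no supremum has to be measured. *)
Lemma bessel_maximal (f : nat -> T -> R) (C : R) (a w : nat -> R) :
  (forall i, measurable_fun setT (f i)) -> 0 <= C -> bessel_system f C ->
  (forall i, 0 <= w i) -> (forall i, a i ^+ 2 <= w i `^ (4 / 3)) ->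
  forall m n, exists G : T -> R,
    [/\ measurable_fun setT G,
        forall t, 0 <= G t,
        forall t k, (m <= k <= n)%N ->
          (\sum_(m <= i < k) a i * f i t) ^+ 2 <= G t &
        (\int[mu]_t (G t)%:E <=
         (150 * C * (\sum_(m <= i < n) w i) `^ (4 / 3))%:E)%E].
Proof.
move=> mf C0 bf w0 aw.
have mS m n : measurable_fun setT (fun t => \sum_(m <= i < n) a i * f i t).
  by apply: measurable_sum => i; apply: measurable_funM.
pose dominated m n := exists G : T -> R,
    [/\ measurable_fun setT G, forall t, 0 <= G t,
        forall t k, (m <= k <= n)%N ->
          (\sum_(m <= i < k) a i * f i t) ^+ 2 <= G t &
        (\int[mu]_t (G t)%:E <=
         (150 * C * (\sum_(m <= i < n) w i) `^ (4 / 3))%:E)%E].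
suff IH N : forall m n, (n - m <= N)%N -> dominated m n.
  by move=> m n; exact: (IH _ m n (leqnn _)).
have base m n : (n <= m)%N -> dominated m n.
  move=> nm; exists (cst 0); split=> //= [t k /andP[_ kn]|].
    by rewrite big_geq ?expr0n // (leq_trans kn).
  by rewrite integral0 lee_fin !mulr_ge0 ?powR_ge0.
elim: N => [|N IH] m n nmN; have [nm|mn] := leqP n m; try exact: base.
  by move: nmN; rewrite leqn0 subn_eq0 leqNgt mn.
have [k0 [/andP[mk0 k0n] hl hr]] := half_mass_index mn w0.
have [|G1 [mG1 G10 G1k iG1]] := IH m k0; first by lia.
have [|G2 [mG2 G20 G2k iG2]] := IH k0.+1 n; first by lia.
set s := \sum_(m <= i < n) w i in hl hr *.
have s0 : 0 <= s by rewrite sumr_ge0.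
have half u : 0 <= u -> u <= s / 2 -> u `^ (4 / 3) <= 2 / 5 * s `^ (4 / 3).
  move=> u0 us; apply: le_trans (powR_half_le s0).
  by rewrite ge0_ler_powR ?nnegrE ?divr_ge0.
pose S t := \sum_(m <= i < k0.+1) a i * f i t.
have iS : (\int[mu]_t (S t ^+ 2)%:E <= (C * s `^ (4 / 3))%:E)%E.
  apply: le_trans (bf _ _ _) _; rewrite lee_fin ler_wpM2l //.
  apply: (@le_trans _ _ (\sum_(m <= i < k0.+1) w i `^ (4 / 3))).
    exact: ler_sum.
  apply: le_trans (powR_superadditive_sum _ _ _ w0) _; first by lra.
  rewrite ge0_ler_powR ?nnegrE ?sumr_ge0 //.
  by rewrite [leRHS](big_cat_nat (n := k0.+1)) ?(leqW mk0) //= lerDl sumr_ge0.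
have l0 := sumr_ge0 _ (fun i _ => w0 i).
exists (fun t => 6 / 5 * (G1 t + G2 t) + 6 * S t ^+ 2); split.
- apply: measurable_funD; apply: measurable_funM => //.
    exact: measurable_funD.
  exact/measurable_funX/mS.
- by move=> t; apply: addr_ge0; apply: mulr_ge0; rewrite ?addr_ge0 ?sqr_ge0.
- move=> t k /andP[mk kn]; have S2 := sqr_ge0 (S t).
  have := G10 t; have := G20 t; have [kk0|k0k] := leqP k k0.
    by have := G1k t k; rewrite mk kk0 => /(_ isT); lra.
  have := G2k t k; rewrite k0k kn => /(_ isT).
  rewrite (big_cat_nat (m := m) (n := k0.+1)) ?(leqW mk0) //= -/(S t).
  set v := bigop _ _ _; have := sqr_ge0 (5 * S t - v); lra.
- have mG := measurable_funD mG1 mG2.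
  have mS2 : measurable_fun setT (fun t => S t ^+ 2) by exact/measurable_funX/mS.
  under eq_integral do rewrite EFinD.
  rewrite ge0_integralD //; first last.
  + by apply/measurable_EFinP/measurable_funM.
  + by move=> t _; rewrite lee_fin mulr_ge0 ?sqr_ge0.
  + by apply/measurable_EFinP/measurable_funM.
  + by move=> t _; rewrite lee_fin mulr_ge0 ?addr_ge0.
  under eq_integral do rewrite EFinM.
  under [X in (_ + X)%E]eq_integral do rewrite EFinM.
  rewrite !ge0_integralZl_EFin //; first last.
  + exact/measurable_EFinP.
  + by move=> t _; rewrite lee_fin addr_ge0.
  + exact/measurable_EFinP.
  + by move=> t _; rewrite lee_fin sqr_ge0.
  under eq_integral do rewrite EFinD.
  rewrite ge0_integralD //; try exact/measurable_EFinP.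
  + have {}half1 := half _ (sumr_ge0 _ (fun i _ => w0 i)) hl.
    have {}half2 := half _ (sumr_ge0 _ (fun i _ => w0 i)) hr.
    apply: le_trans (leeD (lee_wpmul2l _ (leeD iG1 iG2)) (lee_wpmul2l _ iS)) _.
    * by rewrite lee_fin.
    * by rewrite lee_fin.
    rewrite -!EFinD lee_fin.
    have := ler_wpM2l C0 half1; have := ler_wpM2l C0 half2.
    have : 0 <= C * s `^ (4 / 3) by rewrite mulr_ge0 ?powR_ge0.
    lra.
  + by move=> t _; rewrite lee_fin.
  + by move=> t _; rewrite lee_fin.
Qed.
End MaximalInequality.

(** * Almost everywhere convergence for one numerical sequence *)

Section Summability.
Variable R : realType.

Lemma nneseries_lty_cvg0 (u : nat -> R) : (forall j, 0 <= u j) ->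
  (\sum_(0 <= j <oo) (u j)%:E < +oo)%E -> u @ \oo --> (0 : R).
Proof.
move=> u0 sumu; suff /fine_cvgP[_] : (EFin \o u) j @[j --> \oo] --> 0%E by [].
have tail0 : (\sum_(N <= k <oo) (u k)%:E)%E @[N --> \oo] --> 0%E.
  by apply: nneseries_tail_cvg => // k _; rewrite lee_fin.
apply: (squeeze_cvge _ (cvg_cst _) tail0); near=> N => /=.
rewrite lee_fin u0 /=.
have := @nneseries_lim_ge R (EFin \o u) predT N N.+1.
by rewrite big_nat1; apply => n _ _ /=; rewrite lee_fin.
Unshelve. all: by end_near. Qed.

Lemma ae_summable d (T : measurableType d) (mu : {measure set T -> \bar R})
    (u : nat -> T -> R) :
  (forall j, measurable_fun setT (u j)) -> (forall j t, 0 <= u j t) ->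
  (\sum_(0 <= j <oo) \int[mu]_t (u j t)%:E < +oo)%E ->
  {ae mu, forall t, (\sum_(0 <= j <oo) (u j t)%:E < +oo)%E}.
Proof.
move=> mu_ u0 sumu.
have mue j : measurable_fun setT (fun t => (u j t)%:E) by exact/measurable_EFinP.
pose f t := (\sum_(0 <= j <oo) (u j t)%:E)%E.
have f0 t : (0 <= f t)%E by apply: nneseries_ge0 => j _ _; rewrite lee_fin.
have mf : measurable_fun setT f.
  by apply: ge0_emeasurable_sum => // j t _ _; rewrite lee_fin.
have /(integrable_ae measurableT) : mu.-integrable setT f.
  apply/integrableP; split=> //.
  under eq_integral do rewrite gee0_abs //.
  by rewrite integral_nneseries // => j t _; rewrite lee_fin.
apply: filterS => t /(_ I) ft.
by rewrite -(ge0_fin_numE (f0 t)).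
Qed.

End Summability.

Section BesselAverages.
Variables (R : realType) (d : measure_display) (T : measurableType d).
Variable mu : {measure set T -> \bar R}.

(** The truncated [l^(3/2)] mass of the coefficients at the scale [2 ^ j]; the
    truncation bounds the contribution of each large coefficient by 1, so that
    the mass at a scale [j] has an expectation even for [X 1] merely
    integrable. *)
Definition dyadic_mass (x : nat -> R) (j : nat) : R :=
  \sum_(1 <= k < (2 ^ j).+1) trunc_pow (x k / 2 ^+ j).

Lemma dyadic_mass_ge0 x j : 0 <= dyadic_mass x j.
Proof. by apply: sumr_ge0 => k _; exact: trunc_pow_ge0. Qed.

(** At each scale [j] one majorant, with an integral of the order of the mass,
    controls the partial sums of all orders [n <= 2 ^ j] divided by [2 ^ j];
    since the masses are summable, the majorants tend to 0 almost everywhere. *)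
Lemma bessel_averages (f : nat -> T -> R) (C : R) (x : nat -> R) :
  (forall i, measurable_fun setT (f i)) -> 0 <= C -> bessel_system mu f C ->
  (\sum_(0 <= j <oo) (dyadic_mass x j)%:E < +oo)%E ->
  {ae mu, forall t,
    (\sum_(1 <= k < n.+1) x k * f k t) / n%:R @[n --> \oo] --> (0 : R)}.
Proof.
move=> mf C0 bf sumx.
have [j0 _ mass_lt1] : \forall j \near \oo, dyadic_mass x j < 1.
  have /cvgrPdist_lt/(_ 1 ltr01) := nneseries_lty_cvg0 (dyadic_mass_ge0 x) sumx.
  by apply: filterS => j; rewrite sub0r normrN ger0_norm ?dyadic_mass_ge0.
have maxG j : exists G : T -> R,
    [/\ measurable_fun setT G, forall t, 0 <= G t,
        (j0 <= j)%N -> forall t n, (n <= 2 ^ j)%N ->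
          (\sum_(1 <= i < n.+1) x i / 2 ^+ j * f i t) ^+ 2 <= G t &
        (\int[mu]_t (G t)%:E <= (150 * C * dyadic_mass x j)%:E)%E].
  have [jj0|j0j] := ltnP j j0.
    exists (cst 0); split=> //.
    by rewrite integral0 lee_fin !mulr_ge0 ?dyadic_mass_ge0.
  (* at a scale where the total mass is below 1, no term is truncated *)
  pose w i := `|x i / 2 ^+ j| `^ (3 / 2).
  have massE : dyadic_mass x j = \sum_(1 <= i < (2 ^ j).+1) w i.
    apply: eq_big_nat => k kj.
    have : trunc_pow (x k / 2 ^+ j) < 1.
      apply: le_lt_trans (mass_lt1 j j0j).
      rewrite /dyadic_mass (bigD1_seq k) ?mem_index_iota ?iota_uniq //=.
      by rewrite lerDl sumr_ge0 // => i _; exact: trunc_pow_ge0.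
    by rewrite /trunc_pow /w minEle; case: ifP => //; rewrite ltxx.
  have [i|i|G [mG G0 Gk iG]] := @bessel_maximal _ _ _ mu f C
      (fun i => x i / 2 ^+ j) w mf C0 bf _ _ 1%N (2 ^ j).+1.
  - exact: powR_ge0.
  - rewrite -powRrM (_ : 3 / 2 * (4 / 3) = 2%:R); last by field.
    by rewrite powR_mulrn // real_normK ?num_real.
  exists G; split=> // [_ t n nj|]; first by apply: Gk; rewrite !ltnS.
  apply: le_trans iG _; rewrite lee_fin ler_wpM2l ?mulr_ge0 // -massE.
  (* s ^ (4 / 3) <= s, because s <= 1 *)
  apply: powR_ratio_le => //; rewrite ?dyadic_mass_ge0 //.
  by rewrite exprS ler_piMl ?exprn_ge0 ?dyadic_mass_ge0 // ltW // mass_lt1.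
have [G /all_and4[mG G0 Gn iG]] := choice maxG.
have : (\sum_(0 <= j <oo) \int[mu]_t (G j t)%:E < +oo)%E.
  apply: (@le_lt_trans _ _ (\sum_(0 <= j <oo) (150 * C * dyadic_mass x j)%:E)%E).
    by apply: lee_nneseries => // j _ _; apply: integral_ge0 => t _; rewrite lee_fin.
  under eq_eseriesr do rewrite EFinM.
  rewrite nneseriesZl; last by move=> j _; rewrite lee_fin dyadic_mass_ge0.
  by rewrite lte_mul_pinfty // lee_fin mulr_ge0.
move=> /(ae_summable mG G0); apply: filterS => t /(nneseries_lty_cvg0 (G0 ^~ t)).
move=> /cvgrPdist_lt G_cvg; apply/cvgrPdist_lt => e e0.
have [] := G_cvg ((e / 2) ^+ 2); first by rewrite exprn_gt0 // divr_gt0.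
move=> J _ GJ; exists (2 ^ maxn j0 J)%N => //= n Jn.
have n0 : (0 < n)%N by rewrite (leq_trans _ Jn) // expn_gt0.
(* the scale used is [2 ^ j.+1], where [2 ^ j <= n < 2 ^ j.+1] *)
have /andP[nj1 nj2] := trunc_log_bounds (isT : (1 < 2)%N) n0.
have := trunc_log_max (isT : (1 < 2)%N) Jn; set j := trunc_log 2 n in nj1 nj2 *.
rewrite geq_max => /andP[j0j Jj].
have Gj := Gn j.+1 (leqW j0j) t n (ltnW nj2).
have := GJ j.+1 (leqW Jj); rewrite /= sub0r normrN ger0_norm // => Ge.
have := le_lt_trans Gj Ge.
have -> : \sum_(1 <= i < n.+1) x i / 2 ^+ j.+1 * f i t =
    (\sum_(1 <= i < n.+1) x i * f i t) / 2 ^+ j.+1.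
  by rewrite mulr_suml; apply: eq_bigr => i _; rewrite mulrAC.
rewrite -[_ ^+ 2]real_normK ?num_real // ltr_pXn2r ?nnegrE //; last first.
  by rewrite ltW // divr_gt0.
rewrite sub0r normrN !normrM !normfV.
set S := `|_|; have S0 : 0 <= S by exact: normr_ge0.
rewrite ger0_norm ?exprn_ge0 // ger0_norm // ltr_pdivrMr ?exprn_gt0 //.
rewrite ltr_pdivrMr ?ltr0n //.
have : (2 ^+ j.+1 : R) <= 2 * n%:R by rewrite exprS ler_wpM2l // -natrX ler_nat.
nra.
Qed.

End BesselAverages.

(** * Identically distributed coefficients *)

Section AeSwap.
Variables (d1 d2 : measure_display) (T1 : measurableType d1).
Variables (T2 : measurableType d2) (R : realType).
Variable m1 : {sigma_finite_measure set T1 -> \bar R}.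
Variable m2 : {sigma_finite_measure set T2 -> \bar R}.

(** The measurable function [limsup |u n|] detects the limit 0, so Tonelli's
    theorem for it exchanges the two quantifiers. *)
Lemma ae_swap_cvg0 (u : nat -> T1 * T2 -> R) :
  (forall n, measurable_fun setT (u n)) ->
  {ae m2, forall y, {ae m1, forall x, u n (x, y) @[n --> \oo] --> (0 : R)}} ->
  {ae m1, forall x, {ae m2, forall y, u n (x, y) @[n --> \oo] --> (0 : R)}}.
Proof.
move=> mu_ ae0.
pose F z := limn_esup (fun n => `|u n z|%:E).
have F0 z : (0 <= F z)%E.
  by apply: limf_esup_ge0 => // n; rewrite lee_fin.
have mF : measurable_fun setT F.
  apply: measurable_fun_limn_esup => n.
  by apply/measurable_EFinP; exact: measurableT_comp.
have FP z : F z = 0%E <-> u n z @[n --> \oo] --> (0 : R).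
  split=> [Fz|uz].
    apply/norm_cvg0P; have /fine_cvgP[_] // :
        `|u n z|%:E @[n --> \oo] --> 0%:E.
      by apply: limn_esup_le_cvg => [|n]; rewrite ?lee_fin // -[limn_esup _]/(F z) Fz.
  have uE : `|u n z|%:E @[n --> \oo] --> 0%:E.
    by apply: cvg_EFin; [exact: nearW | exact/norm_cvg0P].
  rewrite /F is_cvg_limn_esupE; first exact/cvg_lim.
  by apply/cvg_ex; exists 0%E.
have mG : measurable_fun setT (fun y => (\int[m1]_x F (x, y))%E).
  exact: measurable_fun_fubini_tonelli_G.
have mF1 : measurable_fun setT (fun x => (\int[m2]_y F (x, y))%E).
  exact: measurable_fun_fubini_tonelli_F.
have G0 : (\int[m2]_y \int[m1]_x F (x, y) = 0)%E.
  rewrite -[RHS](integral0 m2 setT); apply: ge0_ae_eq_integral => //.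
    by move=> y _; exact: integral_ge0.
  apply: filterS ae0 => y ae_x _ /=.
  rewrite -[RHS](integral0 m1 setT); apply: ge0_ae_eq_integral => //.
    exact: measurableT_comp.
  by apply: filterS ae_x => x /FP.
have /(ae_eq_integral_abs m1 measurableT mF1) :
    (\int[m1]_x `| \int[m2]_y F (x, y)| = 0)%E.
  under eq_integral do rewrite gee0_abs ?integral_ge0 //.
  by rewrite (@fubini_tonelli _ _ _ _ _ m1 m2 F).
apply: filterS => x /(_ I) /= Fx.
have mFx : measurable_fun setT (fun y => F (x, y)) by exact: measurableT_comp.
have /(ae_eq_integral_abs m2 measurableT mFx) : (\int[m2]_y `|F (x, y)| = 0)%E.
  by under eq_integral do rewrite gee0_abs //.
by apply: filterS => y /(_ I) /FP.
Qed.

End AeSwap.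

Section IdenticallyDistributed.
Variables (R : realType) (d : measure_display) (T : measurableType d).
Variable P : probability T R.

Lemma measurable_trunc_pow : measurable_fun setT (@trunc_pow R).
Proof.
apply: measurable_minr => //; apply: (measurableT_comp (measurable_powR _)).
exact: normr_measurable.
Qed.

Variable X : nat -> {RV P >-> R}.
Hypothesis X_id : identically_distributed X [set n | (1 <= n)%N].
Hypothesis X1_int : ('E_P[fun w => `|X 1%N w|%R] < +oo)%E.

Let mtX k j : measurable_fun setT (fun w => trunc_pow (X k w / 2 ^+ j)).
Proof.
apply: (measurableT_comp measurable_trunc_pow).
by apply: measurable_funM => //; exact: measurable_funP.
Qed.

(** By equality of the laws the [2 ^ j] terms of the scale [j] have the same
    expectation as [2 ^ j] copies of the term of [X 1]; summing over [j] under
    the expectation leaves a function of [X 1] bounded by [6 |X 1|]. *)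
Lemma ae_dyadic_mass_summable :
  {ae P, forall w, (\sum_(0 <= j <oo) (dyadic_mass (X ^~ w) j)%:E < +oo)%E}.
Proof.
apply: ae_summable => [j|j t|].
- exact: measurable_sum.
- exact: dyadic_mass_ge0.
have intE k j : (1 <= k)%N -> (\int[P]_w (trunc_pow (X k w / 2 ^+ j))%:E =
    \int[P]_w (trunc_pow (X 1%N w / 2 ^+ j))%:E)%E.
  move=> k1; pose g y := (trunc_pow (y / 2 ^+ j : R))%:E.
  have mg : measurable_fun setT g.
    apply/measurable_EFinP/(measurableT_comp measurable_trunc_pow).
    exact: measurable_funM.
  have g0 y : (0 <= g y)%E by rewrite lee_fin trunc_pow_ge0.
  rewrite -!(ge0_integral_distribution _ mg g0).
  by apply: eq_measure_integral => A mA _; exact: X_id.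
have massE j : (\int[P]_w (dyadic_mass (X ^~ w) j)%:E =
    \int[P]_w (2 ^+ j * trunc_pow (X 1%N w / 2 ^+ j))%:E)%E.
  transitivity (\int[P]_w \sum_(1 <= k < (2 ^ j).+1)
      (trunc_pow (X 1%N w / 2 ^+ j))%:E)%E; last first.
    apply: eq_integral => w _.
    by rewrite sumEFin sumr_const_nat subSS subn0 -[_ *+ (2 ^ j)]mulr_natl natrX.
  under eq_integral do rewrite -sumEFin.
  rewrite !ge0_integral_sum //; first last.
  - by move=> k w _; rewrite lee_fin trunc_pow_ge0.
  - by move=> k; exact/measurable_EFinP.
  - by move=> k w _; rewrite lee_fin trunc_pow_ge0.
  - by move=> k; exact/measurable_EFinP.
  by apply: eq_big_nat => k /andP[k1 _]; exact: intE.
under eq_eseriesr do rewrite massE.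
rewrite -integral_nneseries //; first last.
- by move=> j w _; rewrite lee_fin mulr_ge0 ?exprn_ge0 ?trunc_pow_ge0.
- by move=> j; apply/measurable_EFinP/measurable_funM.
apply: (@le_lt_trans _ _ (\int[P]_w (6 * `|X 1%N w|)%:E)%E).
  apply: ge0_le_integral => //.
  - by move=> w _; apply: nneseries_ge0 => j _ _;
      rewrite lee_fin mulr_ge0 ?exprn_ge0 ?trunc_pow_ge0.
  - apply: ge0_emeasurable_sum => [j w _ _|j _].
      by rewrite lee_fin mulr_ge0 ?exprn_ge0 ?trunc_pow_ge0.
    by apply/measurable_EFinP/measurable_funM.
  - apply/measurable_EFinP/measurable_funM => //.
    by apply: measurableT_comp => //; exact: measurable_funP.
  - move=> w _; apply: lime_le.
      by apply: is_cvg_nneseries => j _ _; rewrite lee_fin mulr_ge0 ?exprn_ge0 ?trunc_pow_ge0.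
    by apply: nearW => J; rewrite sumEFin lee_fin sum_dyadic_trunc_pow_le.
under eq_integral do rewrite EFinM.
rewrite ge0_integralZl_EFin //; first last.
- apply/measurable_EFinP; apply: measurableT_comp => //; exact: measurable_funP.
- by move: X1_int; rewrite unlock => X1; rewrite lte_mul_pinfty.
Qed.

Lemma ae_bessel_averages d' (T' : measurableType d')
    (mu : {sigma_finite_measure set T' -> \bar R}) (f : nat -> T' -> R) (C : R) :
  (forall i, measurable_fun setT (f i)) -> 0 <= C -> bessel_system mu f C ->
  {ae mu, forall t, {ae P, forall w,
    (\sum_(1 <= k < n.+1) X k w * f k t) / n%:R @[n --> \oo] --> (0 : R)}}.
Proof.
move=> mf C0 bf.
pose u n (z : T' * T) := (\sum_(1 <= k < n.+1) X k z.2 * f k z.1) / n%:R.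
apply: (@ae_swap_cvg0 _ _ _ _ _ mu P u).
- move=> n; apply: measurable_funM => //; apply: measurable_sum => k.
  apply: measurable_funM.
    by apply: (measurableT_comp _ measurable_snd); exact: measurable_funP.
  exact: (measurableT_comp (mf k) measurable_fst).
- by apply: filterS ae_dyadic_mass_summable => w; exact: (bessel_averages mf C0 bf).
Qed.

End IdenticallyDistributed.

(** * Orthogonal systems and the trigonometric system *)

Lemma orthogonal_bessel_system (R : realType) d (T : measurableType d)
    (mu : {measure set T -> \bar R}) (f : nat -> T -> R) (C : R) :
  (forall i j, mu.-integrable setT (fun t => (f i t * f j t)%:E)) ->
  (forall i j, i != j -> (\int[mu]_t (f i t * f j t)%:E = 0)%E) ->
  (forall i, (\int[mu]_t (f i t * f i t)%:E <= C%:E)%E) ->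
  bessel_system mu f C.
Proof.
move=> intf orth normf a m n.
have -> : (\int[mu]_t ((\sum_(m <= i < n) a i * f i t) ^+ 2)%:E =
    \sum_(m <= i < n) \sum_(m <= j < n)
      (a i * a j)%:E * \int[mu]_t (f i t * f j t)%:E)%E.
  under eq_integral => t _.
    rewrite (_ : (_ ^+ 2)%:E = (\sum_(m <= i < n) \sum_(m <= j < n)
      ((a i * a j)%:E * (f i t * f j t)%:E))%E); first over.
    rewrite expr2 mulr_suml -sumEFin; apply: eq_bigr => i _.
    rewrite mulr_sumr -sumEFin; apply: eq_bigr => j _.
    by rewrite -EFinM mulrACA.
  rewrite integral_sum // => [|i]; last first.
    by apply: integrable_sum => // j _; exact: integrableZl.
  apply: eq_bigr => i _; rewrite integral_sum // => [|j]; last first.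
    exact: integrableZl.
  by apply: eq_bigr => j _; rewrite integralZl.
rewrite EFinM -sumEFin ge0_sume_distrr; last by move=> i _; rewrite lee_fin sqr_ge0.
rewrite !big_nat; apply: lee_sum => i imn.
rewrite (bigD1_seq i) ?mem_index_iota ?iota_uniq //=.
rewrite big1 => [|j ji]; last by rewrite orth ?mule0 // eq_sym.
by rewrite adde0 -expr2 muleC lee_wpmul2r // lee_fin sqr_ge0.
Qed.

Section TrigonometricSystem.
Variable R : realType.
Local Notation mu := (@lebesgue_measure R).
Local Notation period := (`[- pi, pi]%classic : set R).

Let pi_lt : - pi < pi :> R.
Proof. by rewrite (lt_trans (y := 0)) ?oppr_lt0 ?pi_gt0. Qed.

Let continuous_cos_affine (c b : R) : continuous (fun t => cos (c * t + b)).
Proof.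
move=> t; apply: (@continuous_comp _ _ _ (fun t => c * t + b) cos).
  by apply: cvgD; [apply: cvgM; [exact: cvg_cst|exact: cvg_id]|exact: cvg_cst].
exact: continuous_cos.
Qed.

Lemma integral_cos_period (n : nat) (b : R) : (0 < n)%N ->
  (\int[mu]_(t in period) (cos (n%:R * t + b))%:E = 0)%E.
Proof.
move=> n0; have n_neq0 : n%:R != 0 :> R by rewrite pnatr_eq0 -lt0n.
pose F t : R := sin (n%:R * t + b) / n%:R.
have dF (t : R) : is_derive t (1 : R) F (cos (n%:R * t + b)).
  apply: is_derive_eq; rewrite !scaler0 add0r addr0 /GRing.scale /= mulr1.
  by rewrite mulrCA mulVf ?mulr1.
rewrite (@continuous_FTC2 _ (fun t => cos (n%:R * t + b)) F _ _ pi_lt).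
- rewrite -EFinB /F -mulrBl (_ : n%:R * pi + b = n%:R * - pi + b + pi *+ 2 *+ n).
    by rewrite (periodicn (@sinD2pi R)) subrr mul0r.
  by rewrite -[_ *+ n]mulr_natl; ring.
- exact/continuous_subspaceT/continuous_cos_affine.
- have cF : continuous F by move=> t; apply/differentiable_continuous/derivable1_diffP.
  split.
  + by move=> t _; exact: ex_derive.
  + exact/cvg_at_right_filter/cF.
  + exact/cvg_at_left_filter/cF.
- by move=> t _; rewrite derive1E derive_val.
Qed.

(** The phase [b] covers cosines and sines by one family: [b = - pi / 2] gives
    [sin (k t)].  The waves are cut off outside a period, because the system is
    considered on the whole line. *)
Definition trig_wave (b : R) (k : nat) : R -> R :=
  (fun t => cos (k%:R * t + b)) \_ period.

Lemma measurable_trig_wave b k : measurable_fun setT (trig_wave b k).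
Proof.
apply: (measurable_restrictT _ _).1 => //; apply: measurable_funTS.
by apply: continuous_measurable_fun; exact: continuous_cos_affine.
Qed.

(** Orthogonality comes from
    [cos u * cos v = (cos (u - v) + cos (u + v)) / 2], whose two terms have
    nonzero integer frequencies [i - j] and [i + j] when [j < i].  The bound
    [2 pi] for the squared norms also holds for the constant wave [k = 0]. *)
Lemma bessel_system_trig_wave b : bessel_system mu (trig_wave b) (2 * pi).
Proof.
have prodE i j : (fun t => (trig_wave b i t * trig_wave b j t)%:E) =
    (EFin \o (fun t => cos (i%:R * t + b) * cos (j%:R * t + b))) \_ period.
  apply/funext => t; rewrite /trig_wave !patchE /=.
  by case: ifP => // _; rewrite mulr0.
have cint c e : mu.-integrable period (EFin \o (fun t => cos (c * t + e))).
  apply: continuous_compact_integrable; first exact: segment_compact.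
  exact/continuous_subspaceT/continuous_cos_affine.
have intf i j : mu.-integrable period
    (EFin \o (fun t => cos (i%:R * t + b) * cos (j%:R * t + b))).
  apply: continuous_compact_integrable; first exact: segment_compact.
  apply: continuous_subspaceT => t.
  by apply: cvgM; exact: continuous_cos_affine.
apply: orthogonal_bessel_system => [i j|i j ij|i].
- by rewrite prodE -integrable_mkcond.
- wlog ij_lt : i j ij / (j < i)%N => [IH|].
    have [ji|ij_lt|/eqP] := ltngtP j i; first exact: IH.
      under eq_integral do rewrite mulrC.
      by apply: IH => //; rewrite eq_sym.
    by rewrite eq_sym (negbTE ij).
  have cosM t : cos (i%:R * t + b) * cos (j%:R * t + b) =
      2^-1 * (cos ((i - j)%N%:R * t + 0) + cos ((i + j)%N%:R * t + 2 * b)).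
    rewrite natrB ?(ltnW ij_lt) // natrD.
    have -> : (i%:R - j%:R) * t + 0 = (i%:R * t + b) - (j%:R * t + b) by ring.
    have -> : (i%:R + j%:R) * t + 2 * b = (i%:R * t + b) + (j%:R * t + b) by ring.
    by move: (i%:R * t + b) (j%:R * t + b) => u v; rewrite cosB cosD; field.
  rewrite prodE -integral_mkcond /=.
  under eq_integral do rewrite cosM EFinM EFinD.
  rewrite integralZl //; last first.
    by apply: integrableD => //; exact: cint.
  rewrite integralD ?cint // !integral_cos_period ?adde0 ?mule0 ?subn_gt0 //.
  by rewrite addn_gt0 (leq_ltn_trans _ ij_lt).
- rewrite prodE -integral_mkcond.
  apply: (@le_trans _ _ (\int[mu]_(t in period) cst 1%E t)%E).
    apply: ge0_le_integral => //=.
    + by move=> t _; rewrite lee_fin -expr2 sqr_ge0.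
    + exact: measurable_int (intf i i).
    + move=> t _; rewrite lee_fin -expr2 -real_normK ?num_real //.
      by rewrite expr_le1 // cos_max.
  have mu_period : mu period = (2 * pi)%:E.
    by rewrite lebesgue_measure_itv /= lte_fin pi_lt -EFinD; congr EFin; ring.
  by rewrite integral_cst // mul1e [leLHS]mu_period.
Qed.

End TrigonometricSystem.

(** * Complex averages *)

Section ComplexAverages.
Variable R : realType.

Lemma cvg_complex_plane0 (a b : nat -> R) :
  a n @[n --> \oo] --> (0 : R) -> b n @[n --> \oo] --> (0 : R) ->
  ((a n +i* b n : complex_plane R) @[n --> \oo]) --> (0 : complex_plane R).
Proof.
move=> /cvgrPdist_lt a0 /cvgrPdist_lt b0.
apply/cvgrPdist_lt => -[e e']; rewrite [_ < _]ltcE /= => /andP[/eqP-> e0].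
have e2 : 0 < e / 2 by rewrite divr_gt0.
apply: filterS2 (a0 _ e2) (b0 _ e2) => n; rewrite !sub0r !normrN => an bn.
apply: le_lt_trans (_ : (`|a n| + `|b n|)%:C < _); last first.
  by rewrite ltcR; lra.
rewrite normc_def lecR -[leRHS]ger0_norm ?addr_ge0 // -sqrtr_sqr ler_wsqrtr //.
by rewrite sqrrD !real_normK ?num_real // lerD2r lerDl mulrn_wge0 // mulr_ge0.
Qed.

Lemma cexp_imaginary (k : nat) (t : R) :
  cexp ('i * k%:R * t%:C) = cos (k%:R * t) +i* sin (k%:R * t).
Proof.
rewrite /cexp.
have -> : 'i * k%:R * t%:C = 0 +i* (k%:R * t) :> R[i].
  by rewrite -(rmorph_nat (real_complex R)) -mulrA -rmorphM; simpc.
by rewrite [complex.Re _]/= [complex.Im _]/= expR0 mul1r.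
Qed.

Lemma trig_sumE (T : Type) (X : nat -> T -> R) n t w :
  trig_sum X n t w / n%:R =
  ((\sum_(1 <= k < n.+1) X k w * cos (k%:R * t)) / n%:R) +i*
  ((\sum_(1 <= k < n.+1) X k w * sin (k%:R * t)) / n%:R).
Proof.
rewrite /trig_sum -(rmorph_nat (real_complex R)).
under eq_bigr do rewrite cexp_imaginary.
have -> : \sum_(1 <= k < n.+1)
      (cos (k%:R * t) +i* sin (k%:R * t)) * (X k w)%:C =
    (\sum_(1 <= k < n.+1) X k w * cos (k%:R * t)) +i*
    (\sum_(1 <= k < n.+1) X k w * sin (k%:R * t)).
  elim/big_rec3: _ => // k a b _ _ ->; simpc.
  by rewrite mulrC [sin _ * _]mulrC.
by rewrite -fmorphV; simpc.
Qed.

End ComplexAverages.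

Theorem theorem1p2 (R : realType) (d : measure_display) (T : measurableType d)
    (P : probability T R) (X : nat -> {RV P >-> R})
    (X_id : identically_distributed X [set n | (1 <= n)%N])
    (X1_int : ('E_P[fun w => `|X 1%N w|%R] < +oo)%E) :
  {ae (@lebesgue_measure R), forall t, t \in `[- pi, pi[ ->
    {ae P, forall w,
      (trig_sum X n t w / n%:R) @[n --> \oo] --> (0 : complex_plane R)}}.
Proof.
have averages b : {ae (@lebesgue_measure R), forall t, {ae P, forall w,
    (\sum_(1 <= k < n.+1) X k w * trig_wave b k t) / n%:R @[n --> \oo]
      --> (0 : R)}}.
  apply: (ae_bessel_averages X_id X1_int _ _ (bessel_system_trig_wave b)).
  - exact: measurable_trig_wave.
  - by rewrite mulr_ge0 ?pi_ge0.
have ae_lebesgue := ae_filter_ringOfSetsType (@lebesgue_measure R).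
apply: filterS2 (averages 0) (averages (- (pi / 2))) => t ave_cos ave_sin t_pi.
have waveE b k : trig_wave b k t = cos (k%:R * t + b).
  rewrite /trig_wave patchE mem_set //=; move: t_pi; rewrite !in_itv /=.
  by move=> /andP[-> /ltW ->].
apply: filterS2 ave_cos ave_sin => w cos0 sin0.
under eq_cvg do rewrite trig_sumE.
apply: cvg_complex_plane0.
- by under eq_cvg do under eq_bigr do rewrite -[_ * t]addr0 -waveE.
- by under eq_cvg do under eq_bigr do rewrite -cosBpihalf -waveE.
Qed.
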